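(* Suppose that the minimum norm solution $u^\dagger$ satisfies the variational source condition $$\sigma\|u-u^\dagger\|\le\mathcal J(u)-\mathcal J(u^\dagger)+\Psi(\|Tu-Tu^\dagger\|)\quad\text{for all }u\in\mathbb{R}^N$$ for some concave and monotonically increasing function $\Psi$, and let the initial guess $u^0$ be some constant vector. Let the regularization parameter $\alpha=\alpha(v^\delta,\delta)\in\overline S\cap\underline S$ satisfy $\alpha\le\overline\alpha$, where $$\overline\alpha:=\Phi(\delta),\qquad \Phi(t):=\frac{t^2}{\Psi(t)}\ \ (t>0).$$ Then the total error between the regularized solution $u_\alpha^\delta\in\arg\min_{u\in\mathbb{R}^N}F_\alpha(u,v^\delta)$ and the minimum norm solution $u^\dagger$ attains the bound $$E(u_\alpha^\delta,u^\dagger)=\mathcal O\!\left(\frac{\delta^2}{\alpha}\right).$$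
   Context: $\mathcal X=\mathbb{R}^N$, $\mathcal Y=\mathbb{R}^M$ with Euclidean norm $\|\cdot\|$; $T:\mathcal X\to\mathcal Y$ is linear and injective. $\Omega=\{u\in\mathbb{R}^N: u_i\ge 0 \text{ for all } i\}$ and $h$ is its indicator function ($0$ on $\Omega$, $\infty$ off $\Omega$). $D=\nabla$ is the linear discrete gradient operator, $g=\|\cdot\|_1$, and $\mathcal J(u)=g(Du)=\|Du\|_1$ is the discrete total variation. For $\alpha>0$, $F_\alpha(u,v^\delta)=\frac12\|Tu-v^\delta\|^2+\alpha D_{\mathcal J}(u,u^0)+h(u)$, where $D_{\mathcal J}(u,u^0)=\mathcal J(u)-\mathcal J(u^0)-\langle D^T\hat w^0,u-u^0\rangle$ with $\hat w^0\in\partial g(Du^0)$; for constant $u^0$ one has $Du^0=0$ and $\hat w^0=0$ is taken. Data: $v^\dagger\in\mathrm{range}(T)$ is the noiseless measurement and $v^\delta\in\mathcal Y$ satisfies $\|v^\dagger-v^\delta\|\le\delta$, $\delta>0$. The minimum norm solution $u^\dagger\in\Omega$ satisfies $Tu^\dagger=v^\dagger$ and has minimal norm among the (nonnegative, bounded variation) solutions of $Tu=v^\dagger$. In the variational source condition $\sigma\in(0,1]$ is a constant and $\Psi:[0,\infty)\to[0,\infty)$ is a concave, monotonically increasing function with $\Psi(0)=0$. Discrepancy principle: for fixed $1<\underline\tau\le\overline\tau<\infty$, $\overline S=\{\alpha>0:\|Tu_\alpha^\delta-v^\delta\|\le\overline\tau\delta\}$ and $\underline S=\{\alpha>0:\underline\tau\delta\le\|Tu_\alpha^\delta-v^\delta\|\}$.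 Total error functional: $E(u_\alpha^\delta,u^\dagger)=\Lambda\|u_\alpha^\delta-u^\dagger\|$, where $\Lambda\in\mathbb{R}_+$ is a coefficient depending only on $\mathcal J$ and its domain. $\mathcal O(\delta^2/\alpha)$ is meant as $\delta\to0$, with a constant independent of $\delta$, $v^\delta$ and $\alpha$ (it may depend on $\underline\tau,\overline\tau,\sigma,\Lambda$). *)

(* Defs.v *)
From HB Require Import structures.
From mathcomp Require Import all_boot all_order all_algebra.
From mathcomp Require Import all_classical all_reals all_analysis.

Set Implicit Arguments.
Unset Strict Implicit.
Unset Printing Implicit Defensive.

Import Order.TTheory GRing.Theory Num.Theory.
Import numFieldNormedType.Exports.

Local Open Scope classical_set_scope.
Local Open Scope ring_scope.

Definition dotp (R : realType) (n : nat) (x y : 'cV[R]_n) : R :=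
  \sum_i x i 0 * y i 0.

(* The library norm `|x| on matrices is the sup norm, hence these two. *)
Definition norm2 (R : realType) (n : nat) (x : 'cV[R]_n) : R :=
  Num.sqrt (dotp x x).

Definition norm1 (R : realType) (n : nat) (x : 'cV[R]_n) : R :=
  \sum_i `|x i 0|.

(* Discrete gradient on N nodes: row k is the difference quotient between the
   nodes src k and tgt k, at mesh width step k (see gradE). Forward, backward
   and central differences on grids of any dimension are of this form, with
   periodic boundary, or with Neumann boundary (src k = tgt k gives the zero
   row). *)
Definition grad (R : realType) (N K : nat) (src tgt : 'I_K -> 'I_N)
    (step : 'I_K -> R) : 'M[R]_(K, N) :=
  \matrix_(k, i) (((i == tgt k)%:R - (i == src k)%:R) / step k).

Lemma gradE (R : realType) (N K : nat) (src tgt : 'I_K -> 'I_N)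
    (step : 'I_K -> R) (u : 'cV[R]_N) (k : 'I_K) :
  (grad src tgt step *m u) k 0 = (u (tgt k) 0 - u (src k) 0) / step k.
Proof.
have sum_delta j : \sum_i (i == j)%:R * u i 0 = u j 0.
  rewrite (bigD1 j) //= eqxx mul1r big1 ?addr0// => i /negPf ->.
  by rewrite mul0r.
rewrite mxE -(sum_delta (tgt k)) -(sum_delta (src k)) -sumrB mulr_suml.
by apply: eq_bigr => i _; rewrite mxE mulrAC mulrBl.
Qed.

Lemma grad_const (R : realType) (N K : nat) (src tgt : 'I_K -> 'I_N)
    (step : 'I_K -> R) (c : R) :
  grad src tgt step *m const_mx c = 0 :> 'cV[R]_K.
Proof.
by apply/matrixP => k j; rewrite ord1 gradE !mxE subrr mul0r.
Qed.

Definition subdifferential (R : realType) (n : nat) (g : 'cV[R]_n -> R)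
    (w : 'cV[R]_n) : set 'cV[R]_n :=
  [set p | forall w', g w + dotp p (w' - w) <= g w'].

(* Justifies the choice of the subgradient 0 for a constant initial guess. *)
Lemma subdifferential_norm1_grad_const (R : realType) (N K : nat)
    (src tgt : 'I_K -> 'I_N) (step : 'I_K -> R) (c : R) :
  subdifferential (@norm1 R K) (grad src tgt step *m const_mx c) 0.
Proof.
move=> w; rewrite grad_const /norm1 /dotp.
rewrite big1 ?add0r; last by move=> i _; rewrite mxE normr0.
by rewrite big1 ?sumr_ge0// => i _; rewrite mxE mul0r.
Qed.

Definition TV (R : realType) (N K : nat) (D : 'M[R]_(K, N)) (u : 'cV[R]_N) : R :=
  norm1 (D *m u).

Definition bregman (R : realType) (N K : nat) (D : 'M[R]_(K, N))
    (w0 : 'cV[R]_K) (u u0 : 'cV[R]_N) : R :=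
  TV D u - TV D u0 - dotp (D^T *m w0) (u - u0).

Definition orthant (R : realType) (N : nat) : set 'cV[R]_N :=
  [set u | forall i, 0 <= u i 0].

Definition indicator (R : realType) (V : Type) (A : set V) (u : V) : \bar R :=
  if `[< A u >] then 0%E else +oo%E.

Definition objective (R : realType) (N M K : nat)
    (T : {linear 'cV[R]_N -> 'cV[R]_M}) (D : 'M[R]_(K, N))
    (u0 : 'cV[R]_N) (w0 : 'cV[R]_K) (alpha : R) (v : 'cV[R]_M)
    (u : 'cV[R]_N) : \bar R :=
  ((2^-1 * norm2 (T u - v) ^+ 2 + alpha * bregman D w0 u u0)%:E
   + indicator R (@orthant R N) u)%E.

Definition argmin (R : realType) (V : Type) (F : V -> \bar R) : set V :=
  [set u | forall u', (F u <= F u')%E].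

(* TV is real-valued here, so every solution has bounded variation. *)
Definition min_norm_solution (R : realType) (N M : nat)
    (T : {linear 'cV[R]_N -> 'cV[R]_M}) (v : 'cV[R]_M) (u : 'cV[R]_N) : Prop :=
  [/\ orthant u, T u = v
    & forall u', orthant u' -> T u' = v -> norm2 u <= norm2 u'].

(* Only the values of Psi on [0, +oo[ matter. *)
Definition index_function (R : realType) (Psi : R -> R) : Prop :=
  [/\ forall t, 0 <= t -> 0 <= Psi t,
      Psi 0 = 0,
      {in `[0, +oo[ &, {homo Psi : s t / s <= t}}
    & convex_function (E := R^o) `[0, +oo[ (fun t => - Psi t)].

Definition variational_source_condition (R : realType) (N M K : nat)
    (T : {linear 'cV[R]_N -> 'cV[R]_M}) (D : 'M[R]_(K, N)) (sigma : R)
    (Psi : R -> R) (udag : 'cV[R]_N) : Prop :=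
  forall u, sigma * norm2 (u - udag)
    <= TV D u - TV D udag + Psi (norm2 (T u - T udag)).

(* For t > 0 with Psi t = 0 this is +oo, by the library convention 0^-1 = +oo
   in \bar R. *)
Definition Phi (R : realType) (Psi : R -> R) (t : R) : \bar R :=
  ((t ^+ 2)%:E / (Psi t)%:E)%E.

(* ureg is the map alpha |-> u_alpha^delta. *)
Definition S_upper (R : realType) (N M : nat)
    (T : {linear 'cV[R]_N -> 'cV[R]_M}) (tau delta : R) (v : 'cV[R]_M)
    (ureg : R -> 'cV[R]_N) : set R :=
  [set alpha | 0 < alpha /\ norm2 (T (ureg alpha) - v) <= tau * delta].

Definition S_lower (R : realType) (N M : nat)
    (T : {linear 'cV[R]_N -> 'cV[R]_M}) (tau delta : R) (v : 'cV[R]_M)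
    (ureg : R -> 'cV[R]_N) : set R :=
  [set alpha | 0 < alpha /\ tau * delta <= norm2 (T (ureg alpha) - v)].

Definition total_error (R : realType) (N : nat) (Lambda : R)
    (u udag : 'cV[R]_N) : R :=
  Lambda * norm2 (u - udag).

(* Main.v *)
Require Import Defs.
From HB Require Import structures.
From mathcomp Require Import all_boot all_order all_algebra.
From mathcomp Require Import all_classical all_reals all_analysis.
From mathcomp Require Import lra.
Import Order.TTheory GRing.Theory Num.Theory.
Import numFieldNormedType.Exports.
Local Open Scope classical_set_scope.
Local Open Scope ring_scope.

(** Write [u] for the regularized solution [ureg alpha]. Comparing the values
of the Tikhonov functional at its minimizer [u] and at the exact solution
[udag] gives
[2^-1 * |T u - vdelta|^2 + alpha * TV u <= 2^-1 * delta^2 + alpha * TV udag],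
because with a constant initial guess and the subgradient 0 the Bregman distance
is the total variation ([bregman_const]), and because [udag] lies in the
orthant ([argmin_objective_le]). The lower discrepancy inequality makes the
residual of [u] at least [delta], so that [TV u <= TV udag]: regularization does
not increase the total variation. The variational source condition then loses
its total variation terms and leaves [sigma * |u - udag| <= Psi (|T u - T udag|)].

The upper discrepancy inequality bounds [|T u - T udag|] by
[2 * tau_hi * delta] ([norm2_add_le]), and a concave function vanishing at 0
satisfies [Psi (c * delta) <= c * Psi delta] for [1 <= c]
([index_function_sublinear]). Finally [alpha <= Phi delta] says that
[Psi delta <= delta^2 / alpha] ([le_Phi_index_function]). Altogether
[|u - udag| <= (2 * tau_hi / sigma) * (delta^2 / alpha)], for every
[delta > 0] and not only for small ones. *)

Lemma dotp_ge0 (R : realType) (n : nat) (x : 'cV[R]_n) : 0 <= dotp x x.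
Proof. by apply: sumr_ge0 => i _; rewrite -expr2 sqr_ge0. Qed.

Lemma norm2_ge0 (R : realType) (n : nat) (x : 'cV[R]_n) : 0 <= norm2 x.
Proof. exact: sqrtr_ge0. Qed.

Lemma norm2_sqr (R : realType) (n : nat) (x : 'cV[R]_n) :
  norm2 x ^+ 2 = dotp x x.
Proof. by rewrite sqr_sqrtr ?dotp_ge0. Qed.

Lemma norm2N (R : realType) (n : nat) (x : 'cV[R]_n) : norm2 (- x) = norm2 x.
Proof.
by congr Num.sqrt; apply: eq_bigr => i _; rewrite mxE mulrNN.
Qed.

(** The constant is the one of the triangle inequality, but the componentwise
bound [(a + b)^2 <= 2 * a^2 + 2 * b^2] suffices. *)
Lemma norm2_add_le (R : realType) (n : nat) (x y : 'cV[R]_n) (r : R) :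
  norm2 x <= r -> norm2 y <= r -> norm2 (x + y) <= 2 * r.
Proof.
move=> xr yr; have r0 : 0 <= r := le_trans (norm2_ge0 _ _ x) xr.
rewrite -ler_sqr ?nnegrE ?norm2_ge0 ?mulr_ge0// norm2_sqr.
apply: (@le_trans _ _ (2 * dotp x x + 2 * dotp y y)).
  rewrite /dotp !mulr_sumr -big_split /=; apply: ler_sum => i _; rewrite mxE.
  by have := sqr_ge0 (x i 0 - y i 0); nra.
have : norm2 x ^+ 2 <= r ^+ 2 by rewrite ler_sqr ?nnegrE ?norm2_ge0.
have : norm2 y ^+ 2 <= r ^+ 2 by rewrite ler_sqr ?nnegrE ?norm2_ge0.
by rewrite !norm2_sqr => ? ?; nra.
Qed.

Lemma index_function_sublinear (R : realType) (Psi : R -> R) (c t : R) :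
  index_function Psi -> 1 <= c -> 0 <= t -> Psi (c * t) <= c * Psi t.
Proof.
move=> [_ Psi0 _ cvxPsi] c1 t0.
have c0 : 0 < c by apply: lt_le_trans c1.
have cV0 : 0 <= c^-1 by rewrite invr_ge0 ltW.
have cV1 : c^-1 <= 1 by rewrite invf_le1.
(* [t] is the convex combination of [c * t] and 0 with weights [c^-1] and
   [1 - c^-1]. *)
have : - Psi (c^-1 * (c * t) + (1 - c^-1) * 0) <=
       c^-1 * - Psi (c * t) + (1 - c^-1) * - Psi 0.
  apply: (cvxPsi (Itv01 cV0 cV1)); rewrite inE/= in_itv/= andbT//.
  by rewrite mulr_ge0// ltW.
rewrite Psi0 oppr0 !mulr0 !addr0 mulKf ?gt_eqF//.
by rewrite mulrN lerN2 ler_pdivrMl.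
Qed.

(** When [Psi t = 0] the hypothesis is void, since [Phi Psi t] is then infinite,
and the conclusion is trivial. *)
Lemma le_Phi_index_function (R : realType) (Psi : R -> R) (a t : R) :
  0 <= Psi t -> 0 < a -> (a%:E <= Phi Psi t)%E -> Psi t <= t ^+ 2 / a.
Proof.
move=> Psit0 a0; rewrite /Phi inver; case: eqVneq => [-> _|Psit_neq0].
  by rewrite divr_ge0 ?sqr_ge0// ltW.
rewrite -EFinM lee_fin => aPhi.
have Psit : 0 < Psi t by rewrite lt_def Psit_neq0.
by rewrite ler_pdivlMr// mulrC -ler_pdivlMr.
Qed.

Lemma bregman_const (R : realType) (N K : nat) (src tgt : 'I_K -> 'I_N)
    (step : 'I_K -> R) (u : 'cV[R]_N) (c : R) :
  let D := grad src tgt step in bregman D 0 u (const_mx c) = TV D u.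
Proof.
rewrite /bregman /= mulmx0 {2}/TV grad_const /norm1 /dotp.
rewrite big1 => [|i _]; last by rewrite mxE normr0.
rewrite big1 => [|i _]; last by rewrite mxE mul0r.
by rewrite !subr0.
Qed.

Lemma argmin_objective_le (R : realType) (N M K : nat)
    (T : {linear 'cV[R]_N -> 'cV[R]_M}) (src tgt : 'I_K -> 'I_N)
    (step : 'I_K -> R) (c a : R) (v : 'cV[R]_M) (u w : 'cV[R]_N) :
  let D := grad src tgt step in
  argmin (objective T D (const_mx c) 0 a v) u -> orthant w ->
  2^-1 * norm2 (T u - v) ^+ 2 + a * TV D u <=
  2^-1 * norm2 (T w - v) ^+ 2 + a * TV D w.
Proof.
move=> D /(_ w) + w0; rewrite /objective !bregman_const /indicator.
rewrite (asboolT w0) adde0.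
(* A minimizer outside the orthant would have an infinite value, larger than
   the finite one at [w]. *)
by case: asboolP => _; rewrite ?adde0 ?lee_fin.
Qed.

Theorem theorem6p7 (R : realType) (tau_lo tau_hi sigma Lambda : R)
    (htau_lo : 1 < tau_lo) (htau : tau_lo <= tau_hi)
    (hsigma : 0 < sigma <= 1) (hLambda : 0 <= Lambda) :
  exists C : R,
  forall (N M K : nat) (T : {linear 'cV[R]_N -> 'cV[R]_M})
    (src tgt : 'I_K -> 'I_N) (step : 'I_K -> R)
    (vdag : 'cV[R]_M) (udag : 'cV[R]_N) (Psi : R -> R) (c0 : R),
  let D := grad src tgt step in
  let u0 : 'cV[R]_N := const_mx c0 in
  injective T ->
  (forall k, 0 < step k) ->
  range T vdag ->
  min_norm_solution T vdag udag ->
  index_function Psi ->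
  variational_source_condition T D sigma Psi udag ->
  \forall delta \near (0 : R)^'+,
    forall (vdelta : 'cV[R]_M) (ureg : R -> 'cV[R]_N) (alpha : R),
    norm2 (vdag - vdelta) <= delta ->
    (forall a : R, 0 < a -> argmin (objective T D u0 0 a vdelta) (ureg a)) ->
    (S_upper T tau_hi delta vdelta ureg
      `&` S_lower T tau_lo delta vdelta ureg) alpha ->
    (alpha%:E <= Phi Psi delta)%E ->
    total_error Lambda (ureg alpha) udag <= C * (delta ^+ 2 / alpha).
Proof.
have /andP[sigma0 _] := hsigma.
exists (Lambda * (2 * tau_hi / sigma)).
move=> N M K T src tgt step vdag udag Psi c0 D u0 _ _ _ [udag0 Tudag _] iPsi vsc.
have [Psi_ge0 _ Psi_homo _] := iPsi.
near=> delta => vdelta ureg alpha vdelta_le ureg_min [[alpha0 res_le] [_ res_ge]].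
move=> alpha_Phi.
have delta0 : 0 < delta by near: delta; exact: nbhs_right_gt.
set u := ureg alpha in res_le res_ge *.
have TV_le : TV D u <= TV D udag.
  have /argmin_objective_le/(_ udag0) := ureg_min _ alpha0.
  rewrite -/D -/u Tudag => minu.
  have delta_res : delta <= norm2 (T u - vdelta).
    by apply: le_trans res_ge; rewrite ler_peMl ?ltW.
  rewrite -(ler_pM2l alpha0).
  have : norm2 (vdag - vdelta) ^+ 2 <= norm2 (T u - vdelta) ^+ 2.
    by rewrite ler_sqr ?nnegrE ?norm2_ge0// (le_trans vdelta_le).
  by move: minu; lra.
have Tu_le : norm2 (T u - T udag) <= 2 * tau_hi * delta.
  rewrite Tudag -(subrKA vdelta) -mulrA; apply: norm2_add_le => //.
  rewrite -norm2N opprB; apply: le_trans vdelta_le _.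
  by rewrite ler_peMl ?(ltW delta0)// (le_trans (ltW htau_lo)).
have tau1 : 1 <= 2 * tau_hi by lra.
have Psi_le : Psi (norm2 (T u - T udag)) <= 2 * tau_hi * (delta ^+ 2 / alpha).
  apply: (@le_trans _ _ (Psi (2 * tau_hi * delta))).
    apply: Psi_homo => //; rewrite in_itv/= andbT ?norm2_ge0//.
    by rewrite (le_trans _ Tu_le) ?norm2_ge0.
  apply: le_trans (index_function_sublinear _ _ _ _ iPsi tau1 (ltW delta0)) _.
  rewrite ler_pM2l ?(lt_le_trans ltr01)//.
  by apply: le_Phi_index_function => //; exact/Psi_ge0/ltW.
rewrite /total_error -(mulrA Lambda) ler_wpM2l// mulrAC ler_pdivlMr// mulrC.
by have := vsc u; lra.
Unshelve. all: by end_near. Qed.
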